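(* For $1\le e\ll n^2$ we have $\mathrm{un}_4(n,e)=1$. That is, there is an absolute constant $c>0$ such that for all sufficiently large $n$ and all integers $1\le e\le cn^2$, $\mathrm{un}_4(n,e)=1$.
   Context: A $4$-graph is a $4$-uniform hypergraph. A $4$-graph $\mathcal{H}$ is $(n,e)$-unavoidable if every $4$-graph on $n$ vertices with $e$ edges contains a copy of $\mathcal{H}$; $\mathrm{un}_4(n,e)$ is the maximum number of edges of an $(n,e)$-unavoidable $4$-graph. *)

(* Defs.v *)
From HB Require Import structures.
From mathcomp Require Import all_boot all_order all_algebra.
From mathcomp Require Import reals.

Set Implicit Arguments.
Unset Strict Implicit.
Unset Printing Implicit Defensive.

Record rgraph (r : nat) := RGraph {
  vertices : finType;
  edges : {set {set vertices}};
  edges_uniform : forall A : {set vertices}, A \in edges -> #|A| = r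
}.

(* Copies are not required to be induced. *)
Definition contains_copy (r : nat) (G H : rgraph r) : Prop :=
  exists f : vertices H -> vertices G,
    injective f /\ forall A : {set vertices H}, A \in edges H -> f @: A \in edges G.

Definition unavoidable (r n e : nat) (H : rgraph r) : Prop :=
  forall G : rgraph r, #|vertices G| = n -> #|edges G| = e -> contains_copy G H.

(* [is_un r n e k] reads un_r(n,e) = k.  It is a relation because the maximum
   ranges over r-graphs on arbitrary finite vertex sets, and does not exist
   when e > 'C(n, r), where every H is vacuously unavoidable. *)
Definition is_un (r n e k : nat) : Prop :=
  (exists H : rgraph r, unavoidable n e H /\ #|edges H| = k) /\
  (forall H : rgraph r, unavoidable n e H -> #|edges H| <= k).

(* Main.v *)
(* A graph with two edges A, B is avoided by a family of quadratically many
   4-sets: if A and B share at most one vertex, by 4-sets containing a fixed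
   pair, since these pairwise share at least two vertices; if A and B share at
   least two vertices, by the 4-sets with coordinates (a, b, a + b, a + 2b) in
   four disjoint parts, since any two coordinates determine (a, b), so that
   these pairwise share at most one vertex. *)
Require Import Defs.
From HB Require Import structures.
From mathcomp Require Import all_boot all_order all_algebra.
From mathcomp Require Import reals.
From mathcomp Require Import zify.

Set Implicit Arguments.
Unset Strict Implicit.
Unset Printing Implicit Defensive.

Import Order.TTheory GRing.Theory Num.Theory.
Local Open Scope ring_scope.

(** The witness is a lone edge filling the vertex set ['I_r]; enumerating any edge of the host
    embeds it, and [0 < e] supplies such an edge. *)
Lemma single_edge_unavoidable (r n e : nat) : (0 < e)%N ->
  exists H : Defs.rgraph r, unavoidable n e H /\ #|edges H| = 1%N.
Proof.
move=> e_gt0.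
have unif (A : {set 'I_r}) : A \in [set setT] -> #|A| = r.
  by move/set1P->; rewrite cardsT card_ord.
exists (RGraph unif); split; last exact: cards1.
move=> G _ cardG.
have /card_gt0P[A EA] : (0 < #|edges G|)%N by rewrite cardG.
have cA := esym (edges_uniform EA).
exists (fun i => enum_val (cast_ord cA i)); split.
  by move=> i j /enum_val_inj /cast_ord_inj.
move=> _ /set1P->; suff -> : [set enum_val (cast_ord cA i) | i in setT] = A by [].
apply/eqP; rewrite eqEcard; apply/andP; split.
  by apply/subsetP => _ /imsetP[i _ ->]; exact: enum_valP.
rewrite card_imset; first by rewrite cardsT card_ord (edges_uniform EA).
by move=> i j /enum_val_inj /cast_ord_inj.
Qed.

(** Any [e] members of [F] already form a host graph on ['I_n], so an avoiding family may have more
    than [e] members. *)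
Lemma unavoidable_embeds (r n e : nat) (H : Defs.rgraph r) (F : {set {set 'I_n}}) :
  unavoidable n e H -> (e <= #|F|)%N -> {in F, forall A : {set 'I_n}, #|A| = r} ->
  exists f : vertices H -> 'I_n,
    injective f /\ forall A, A \in edges H -> f @: A \in F.
Proof.
move=> unH eF unifF.
pose E := [set A in take e (enum F)].
have EF A : A \in E -> A \in F by rewrite inE => /mem_take; rewrite mem_enum.
have unifE A : A \in E -> #|A| = r by move/EF/unifF.
have cE : #|E| = e.
  rewrite cardsE (card_uniqP _) ?take_uniq ?enum_uniq // size_takel //.
  by rewrite -cardE.
have [|f [injf fE]] := unH (RGraph unifE) _ cE; first exact: card_ord.
by exists f; split=> // A /fE /EF.
Qed.

(** Blocks are kept as lists of naturals so that questions about them reduce to linear arithmetic.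
    Entries that are at least [n] are silently dropped, hence the bound hypotheses below. *)
Definition ord_set (n : nat) (s : seq nat) : {set 'I_n} := [set x | val x \in s].

Lemma mem_ord_set (n : nat) (s : seq nat) (x : nat) :
  all (fun y => y < n)%N s -> x \in s -> exists2 y : 'I_n, y \in ord_set n s & val y = x.
Proof.
by move=> /allP sn xs; exists (Ordinal (sn x xs)); rewrite ?inE.
Qed.

Lemma card_ord_set (n : nat) (s : seq nat) :
  uniq s -> all (fun y => y < n)%N s -> #|ord_set n s| = size s.
Proof.
move=> us sn; rewrite cardE -(size_map val); apply/perm_size/uniq_perm => //.
  by rewrite (map_inj_uniq val_inj) enum_uniq.
move=> x; apply/mapP/idP => [[y]|xs]; first by rewrite mem_enum inE => ys ->.
by have [y ys <-] := mem_ord_set sn xs; exists y; rewrite ?mem_enum.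
Qed.

Lemma ord_set_sub (n : nat) (s t : seq nat) :
  all (fun y => y < n)%N s -> ord_set n s = ord_set n t -> {subset s <= t}.
Proof. by move=> sn st x /(mem_ord_set sn)[y]; rewrite st inE => ? <-. Qed.

Definition pair_block (m a b : nat) : seq nat := [:: 0; 1; 2 + a; 2 + m + b]%N.

(** For [a, b < m] the entries lie in consecutive disjoint intervals of lengths [m], [m], [2 * m]
    and [3 * m]; the total [7 * m] is the room required of [n]. *)
Definition linear_block (m a b : nat) : seq nat :=
  [:: a; m + b; 2 * m + (a + b); 4 * m + (a + 2 * b)]%N.

Definition block_family (n m : nat) (s : nat -> nat -> nat -> seq nat) : {set {set 'I_n}} :=
  [set ord_set n (s m p.1 p.2) | p : 'I_m * 'I_m].

Lemma block_bounds (n m a b : nat) : (7 * m <= n)%N -> (a < m)%N -> (b < m)%N ->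
  all (fun y => y < n)%N (pair_block m a b) /\ all (fun y => y < n)%N (linear_block m a b).
Proof. by rewrite /= !andbT => *; split; apply/and4P; split; lia. Qed.

Lemma block_uniq (m a b : nat) : (a < m)%N -> (b < m)%N ->
  uniq (pair_block m a b) /\ uniq (linear_block m a b).
Proof. by rewrite /= !inE => *; split; lia. Qed.

Lemma pair_family_spec (n m : nat) : (7 * m <= n)%N ->
  [/\ #|block_family n m pair_block| = (m * m)%N,
      {in block_family n m pair_block, forall A : {set 'I_n}, #|A| = 4} &
      {in block_family n m pair_block &, forall A B : {set 'I_n}, 1 < #|A :&: B|}%N].
Proof.
move=> mn; split.
- rewrite card_imset ?card_prod ?card_ord // => -[a b] [c d] /= eqs.
  have [bd _] := block_bounds mn (ltn_ord a) (ltn_ord b).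
  have := ord_set_sub bd eqs (x := (2 + a)%N).
  have := ord_set_sub bd eqs (x := (2 + m + b)%N).
  rewrite !inE !eqxx !orbT => /(_ isT) hb /(_ isT) ha.
  by congr pair; apply: val_inj => /=; have := ltn_ord a; have := ltn_ord c; lia.
- move=> _ /imsetP[[a b] _ ->] /=.
  have [bd _] := block_bounds mn (ltn_ord a) (ltn_ord b).
  have [us _] := block_uniq (ltn_ord a) (ltn_ord b).
  exact: (card_ord_set us bd).
- move=> _ _ /imsetP[[a b] _ ->] /imsetP[[c d] _ ->] /=.
  (* The index [a] forces [0 < m], so the points 0 and 1 shared by all blocks exist in ['I_n]. *)
  have n1 : (1 < n)%N by have := ltn_ord a; lia.
  have n0 := ltnW n1.
  apply/card_gt1P; exists (Ordinal n0), (Ordinal n1).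
  by split; rewrite ?inE.
Qed.

Lemma linear_family_spec (n m : nat) : (7 * m <= n)%N ->
  [/\ #|block_family n m linear_block| = (m * m)%N,
      {in block_family n m linear_block, forall A : {set 'I_n}, #|A| = 4} &
      {in block_family n m linear_block &, forall A B : {set 'I_n}, A != B -> #|A :&: B| <= 1}%N].
Proof.
move=> mn.
(* As the intervals are disjoint, a common element has the same position in both blocks and yields
   one linear equation between the parameters. *)
have blockI (a b c d : 'I_m) (x : nat) :
    x \in linear_block m a b -> x \in linear_block m c d ->
    [\/ x = a /\ a = c :> nat, x = (m + b)%N /\ b = d :> nat,
        x = (2 * m + (a + b))%N /\ (a + b = c + d)%N |
        x = (4 * m + (a + 2 * b))%N /\ (a + 2 * b = c + 2 * d)%N].
  have := (ltn_ord a, ltn_ord b, ltn_ord c, ltn_ord d) => -[[[la lb] lc] ld].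
  rewrite !inE => /or4P[] /eqP -> h;
    [apply: Or41 | apply: Or42 | apply: Or43 | apply: Or44]; split=> //; lia.
split.
- rewrite card_imset ?card_prod ?card_ord // => -[a b] [c d] /= eqs.
  have [_ bd] := block_bounds mn (ltn_ord a) (ltn_ord b).
  have := ord_set_sub bd eqs (x := (a : nat)).
  have := ord_set_sub bd eqs (x := (m + b)%N).
  rewrite !inE !eqxx !orbT => /(_ isT) hb /(_ isT) ha.
  have := (ltn_ord a, ltn_ord b, ltn_ord c, ltn_ord d) => -[[[la lb] lc] ld].
  by congr pair; apply: val_inj => /=; lia.
- move=> _ /imsetP[[a b] _ ->] /=.
  have [_ bd] := block_bounds mn (ltn_ord a) (ltn_ord b).
  have [_ us] := block_uniq (ltn_ord a) (ltn_ord b).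
  exact: (card_ord_set us bd).
- move=> _ _ /imsetP[[a b] _ ->] /imsetP[[c d] _ ->] /= neq.
  rewrite leqNgt; apply: contra neq => /card_gt1P[x [y []]].
  rewrite !in_setI !in_set => /andP[xab xcd] /andP[yab ycd] xy.
  have {}xy : val x <> val y by move/val_inj/eqP; apply/negP.
  have [ac bd] : a = c :> nat /\ b = d :> nat.
    (* Equal positions would give [x = y]; different positions give two independent equations, which
       force [a = c] and [b = d]. *)
    by case: (blockI _ _ _ _ _ xab xcd) => -[xE ?];
      case: (blockI _ _ _ _ _ yab ycd) => -[yE ?]; split;
      first [by case: xy; exact: etrans xE (esym yE) | lia].
  by rewrite ac bd.
Qed.

Lemma unavoidable_edges_le1 (n m e : nat) (H : Defs.rgraph 4) :
  (7 * m <= n)%N -> (e <= m * m)%N -> unavoidable n e H -> (#|edges H| <= 1)%N.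
Proof.
move=> mn em unH; rewrite leqNgt; apply/negP => /card_gt1P[A [B [EA EB AB]]].
have [cP unifP interP] := pair_family_spec mn.
have [cL unifL interL] := linear_family_spec mn.
have [small|big] := leqP #|A :&: B| 1.
  have [|f [injf fE]] := unavoidable_embeds unH _ unifP; first by rewrite cP.
  have := interP _ _ (fE _ EA) (fE _ EB).
  by rewrite -imsetI ?card_imset // => [|? ? _ _ /injf //]; rewrite ltnNge small.
have [|f [injf fE]] := unavoidable_embeds unH _ unifL; first by rewrite cL.
(* The linear family bounds intersections of distinct members only. *)
have fAB : f @: A != f @: B by apply: contra AB => /eqP /(imset_inj injf)->.
have := interL _ _ (fE _ EA) (fE _ EB) fAB.
by rewrite -imsetI ?card_imset // => [|? ? _ _ /injf //]; rewrite leqNgt big.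
Qed.

Theorem theorem4p1 (R : realType) :
  exists c : R, 0 < c /\
    exists N : nat, forall n e : nat,
      (N <= n)%N -> (1 <= e)%N -> e%:R <= c * n%:R ^+ 2 ->
      is_un 4 n e 1.
Proof.
(* 196 = 14 ^ 2, since n <= 14 * (n %/ 7) for n >= 7. *)
exists 196%:R^-1; split; first by rewrite invr_gt0 ltr0n.
exists 7 => n e n7 e_gt0; rewrite mulrC ler_pdivlMr ?ltr0n //.
rewrite -natrX -natrM ler_nat => en.
split; first exact: single_edge_unavoidable.
(* The largest [m] with [7 * m <= n]; it remains to derive [e <= m * m] from [e * 196 <= n ^ 2]. *)
move=> H; apply: (@unavoidable_edges_le1 n (n %/ 7)); first by lia.
have n14 : (n <= 14 * (n %/ 7))%N by lia.
have : (n ^ 2 <= (14 * (n %/ 7)) ^ 2)%N by rewrite leq_sqr.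
by move/(leq_trans en); rewrite expnMn (mulnC e) leq_pmul2l // mulnn.
Qed.
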